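(* Let $G$ be a Polish group, let $X$ be a Polish $G$-space which has a dense orbit, and let $P$ be a Polish group of permutations of a countable set $N$. If all $P$-orbits of $N$ are infinite, then the unbalanced graph of the Polish $(P\,\mathrm{Wr}\,G)$-space $X^N$ is generically semi-connected.
   Context: A Polish group of permutations of a countable set $N$ is a closed subgroup $P$ of the group $S(N)$ of all permutations of $N$ with the pointwise convergence topology. The wreath product $P\,\mathrm{Wr}\,G$ is the Polish group with underlying space $P\times G^N$ (product topology) and multiplication $$(p_2,\boldsymbol g_2)(p_1,\boldsymbol g_1)=(p_2p_1,\boldsymbol h),\qquad \boldsymbol h(n)=\boldsymbol g_2(p_1(n))\,\boldsymbol g_1(n)\quad(n\in N).$$ If $X$ is a Polish $G$-space (a Polish space with a continuous left action of the Polish group $G$), then $X^N$ is a Polish $(P\,\mathrm{Wr}\,G)$-space (the $P$-jump of $G\curvearrowright X$) via $$((p,\boldsymbol g)\cdot\boldsymbol x)(n)=\boldsymbol g(p^{-1}(n))\cdot \boldsymbol x(p^{-1}(n)).$$ For a Polish $\Gamma$-space $Z$ of a Polish group $\Gamma$ and $x,y\in Z$ write $x\leftrightsquigarrow y$ if for every open neighborhood $V$ of the identity of $\Gamma$ and every open $U\subseteq Z$ having nonempty intersection with the orbit of $x$ or with the orbit of $y$, there exist $g^x,g^y\in \Gamma$ with $g^xx\in U$ and $g^yy\in U$ such that $g^yy\in\overline{V(g^xx)}$ and $g^xx\in\overline{V(g^yy)}$. This is symmetric and invariant under the action in each variable, so one writes $[x]\leftrightsquigarrow[y]$ for orbits $[x]=\Gamma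 x$, $[y]=\Gamma y$ when $x\leftrightsquigarrow y$. For a $\Gamma$-invariant $C\subseteq Z$, let $C/\Gamma=\{[x]: x\in C\}$. The unbalanced graph of $Z$ is $(Z/\Gamma,\leftrightsquigarrow)$. A path in $C/\Gamma$ from $[x]$ to $[y]$ is a sequence $x_0,\dots,x_{n-1}\in C$ with $x_0=x$, $x_{n-1}=y$ and $x_{i-1}\leftrightsquigarrow x_i$ for all $0<i<n$. $(Z/\Gamma,\leftrightsquigarrow)$ is generically semi-connected if for every $\Gamma$-invariant comeager $C\subseteq Z$ there is a comeager $D\subseteq C$ such that for all $x,y\in D$ there is a path between $[x]$ and $[y]$ in $(C/\Gamma,\leftrightsquigarrow)$. *)

(* Defs.v *)
From HB Require Import structures.
From mathcomp Require Import all_boot all_order all_algebra.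
From mathcomp Require Import all_classical all_reals topology.

Set Implicit Arguments.
Unset Strict Implicit.
Unset Printing Implicit Defensive.

Local Open Scope classical_set_scope.
Local Open Scope group_scope.

Section Polish.

Definition separable (T : topologicalType) : Prop :=
  exists2 D : set T, countable D & dense D.

Definition complete_space (M : uniformType) : Prop :=
  forall F : set_system M, ProperFilter F -> cauchy F -> exists x : M, F --> x.

Definition homeomorphic (S T : topologicalType) : Prop :=
  exists (f : S -> T) (g : T -> S),
    [/\ cancel f g, cancel g f, continuous f & continuous g].

(* The metric is not part of the data: it is only required to exist. *)
Definition completely_metrizable (R : realType) (T : topologicalType) : Prop :=
  exists2 M : metricType R, complete_space M & homeomorphic T M.

Definition polish (R : realType) (T : topologicalType) : Prop :=
  separable T /\ completely_metrizable R T.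

End Polish.

Section Category.
Variable T : topologicalType.
Implicit Types A C : set T.

Definition nowhere_dense A : Prop := interior (closure A) = set0.

Definition meager A : Prop :=
  exists2 F : nat -> set T,
    (forall i, nowhere_dense (F i)) & A `<=` \bigcup_i F i.

Definition comeager C : Prop := meager (~` C).

End Category.

HB.mixin Record isTopologicalGroup G of Group G & Topological G := {
  mulg_continuous : continuous (fun x : G * G => x.1 * x.2);
  invg_continuous : continuous (fun x : G => x^-1)
}.

#[short(type="topologicalGroupType")]
HB.structure Definition TopologicalGroup :=
  {G of Group G & Topological G & isTopologicalGroup G}.

Record continuousAction (G : topologicalGroupType) (Z : topologicalType) :=
  ContinuousAction {
    act :> G -> Z -> Z;
    act1 : forall x, act 1 x = x;
    actM : forall g h x, act (g * h) x = act g (act h x);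
    act_continuous : continuous (fun gx : G * Z => act gx.1 gx.2)
  }.

Section UnbalancedGraph.
Variables (G : topologicalGroupType) (Z : topologicalType).
Variable a : continuousAction G Z.

Definition action_orbit (x : Z) : set Z := range (a ^~ x).

Definition invariant (C : set Z) : Prop := forall g x, C x -> C (a g x).

Definition unbalanced (x y : Z) : Prop :=
  forall (V : set G) (U : set Z), open_nbhs 1 V -> open U ->
    U `&` action_orbit x !=set0 \/ U `&` action_orbit y !=set0 ->
    exists gx gy : G,
      [/\ U (a gx x), U (a gy y),
          closure [set a v (a gx x) | v in V] (a gy y) &
          closure [set a v (a gy y) | v in V] (a gx x)].

(* The sequence of length n.+1 is given by the values of u at 0, ..., n. *)
Definition unbalanced_path (C : set Z) (x y : Z) : Prop :=
  exists (n : nat) (u : nat -> Z),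
    [/\ u 0%N = x, u n = y,
        forall i, (i <= n)%N -> C (u i) &
        forall i, (i < n)%N -> unbalanced (u i) (u i.+1)].

Definition generically_semi_connected : Prop :=
  forall C : set Z, invariant C -> comeager C ->
    exists D : set Z, [/\ D `<=` C, comeager D &
      forall x y, D x -> D y -> unbalanced_path C x y].

End UnbalancedGraph.

(* All permutations of N; MathComp's {perm N} only covers finite N. *)
Record sym (N : Type) := Sym {
  sym_fun :> N -> N;
  sym_inv : N -> N;
  sym_funK : cancel sym_fun sym_inv;
  sym_invK : cancel sym_inv sym_fun
}.

Section SymGroup.
Variable N : Type.
Implicit Types p q : sym N.

Lemma sym_ext p q : p =1 q -> p = q.
Proof.
case: p q => [f fi fK fiK] [g gi gK giK] /= /funext fg; subst g.
have figi : fi = gi by apply/funext => n; rewrite -[n in LHS]giK fK.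
by subst gi; congr Sym; exact: Prop_irrelevance.
Qed.

Definition sym_one : sym N := @Sym N id id (fun=> erefl) (fun=> erefl).

Definition sym_mul p q : sym N :=
  Sym (can_comp (@sym_funK N p) (@sym_funK N q))
      (can_comp (@sym_invK N q) (@sym_invK N p)).

Definition sym_opp p : sym N := Sym (@sym_invK N p) (@sym_funK N p).

HB.instance Definition _ := gen_eqMixin (sym N).
HB.instance Definition _ := gen_choiceMixin (sym N).

Fact sym_mulA : associative sym_mul. Proof. by move=> *; exact: sym_ext. Qed.
Fact sym_mul1 : left_id sym_one sym_mul. Proof. by move=> *; exact: sym_ext. Qed.
Fact sym_mulr1 : right_id sym_one sym_mul. Proof. by move=> *; exact: sym_ext. Qed.
Fact sym_mulV : left_inverse sym_one sym_opp sym_mul.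
Proof. by move=> p; apply: sym_ext => n /=; rewrite sym_funK. Qed.
Fact sym_mulrV : right_inverse sym_one sym_opp sym_mul.
Proof. by move=> p; apply: sym_ext => n /=; rewrite sym_invK. Qed.

HB.instance Definition _ :=
  isGroup.Build (sym N) sym_mulA sym_mul1 sym_mulr1 sym_mulV sym_mulrV.

End SymGroup.

(* Pointwise convergence: the topology induced from N -> N, N discrete. *)
HB.instance Definition _ (N : countType) :=
  Topological.copy (sym N)
    (initial_topology (fun p : sym N => sym_fun p : {ptws N -> discrete_topology N})).

(* Polish groups of permutations of N: closed subgroups of sym N. *)
Record permGroup (N : countType) := PermGroup {
  perm_set :> set (sym N);
  perm_set1 : perm_set 1;
  perm_setM : forall p q, perm_set p -> perm_set q -> perm_set (p * q);
  perm_setV : forall p, perm_set p -> perm_set p^-1;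
  perm_set_closed : closed perm_set
}.


Section ContinuityLemmas.

Lemma initial_cvg (S : choiceType) (T : topologicalType) (f : S -> T)
    (F : set_system S) (s : S) : Filter F ->
  f @ F --> f s -> F --> (s : initial_topology f).
Proof.
move=> FF fFs A [_ [[B oB <-] Bfs] BA].
by apply: filterS BA _; apply: fFs; exact: open_nbhs_nbhs.
Qed.

Lemma continuous_initial (S : choiceType) (T U : topologicalType) (f : S -> T)
    (g : U -> initial_topology f) : continuous (f \o g) -> continuous g.
Proof. by move=> fg x; apply: initial_cvg; exact: fg. Qed.

Lemma continuous_ptws (U V : topologicalType) (I : Type) (f : U -> {ptws I -> V}) :
  (forall i, continuous (fun u => f u i)) -> continuous f.
Proof.
by move=> fc x; apply/cvg_sup => i; apply: initial_cvg; exact: fc.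
Qed.

Lemma continuous_pair (U V W : topologicalType) (f : U -> V) (g : U -> W) :
  continuous f -> continuous g -> continuous (fun u => (f u, g u)).
Proof. by move=> fc gc u; apply: cvg_pair; [exact: fc|exact: gc]. Qed.

Lemma continuous_compose (U V W : topologicalType) (f : V -> W) (g : U -> V) :
  continuous f -> continuous g -> continuous (fun u => f (g u)).
Proof. by move=> fc gc u; exact: (continuous_comp (gc u) (fc _)). Qed.

Lemma continuous_op2 (U V W Z : topologicalType) (h : V -> W -> Z)
    (f : U -> V) (g : U -> W) :
  continuous (fun x : V * W => h x.1 x.2) -> continuous f -> continuous g ->
  continuous (fun u => h (f u) (g u)).
Proof.
by move=> hc fc gc; exact (continuous_compose hc (continuous_pair fc gc)).
Qed.

Lemma continuous_at_ptws (I : eqType) (V : topologicalType) (i : I) :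
  continuous (fun f : {ptws I -> V} => f i).
Proof. exact: (@proj_continuous I (fun=> V) i). Qed.

Lemma continuous_to_discrete (U : topologicalType) (N : choiceType)
    (f : U -> discrete_topology N) :
  (forall u, \forall v \near u, f v = f u) -> continuous f.
Proof. by move=> fc u; apply/discrete_cvg; exact: fc. Qed.

Lemma continuous_locally_constant (U V : topologicalType) (I : Type)
    (k : U -> I) (f : I -> U -> V) :
  (forall u, \forall v \near u, k v = k u) -> (forall i, continuous (f i)) ->
  continuous (fun u => f (k u) u).
Proof.
move=> kc fc u; apply: cvg_trans (fc (k u) u); apply: near_eq_cvg.
by near=> v; congr f; apply/esym; near: v; exact: kc.
Unshelve. all: by end_near. Qed.

End ContinuityLemmas.

Section SymTopology.
Variable N : countType.

Lemma near_sym (p : sym N) (n : N) : nbhs p [set q : sym N | q n = p n].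
Proof.
pose s (q : sym N) : {ptws N -> discrete_topology N} := q.
have sc : continuous (s : sym N -> _) by exact: initial_continuous.
have ec : continuous (fun q => s q n).
  exact (continuous_compose (@continuous_at_ptws N (discrete_topology N) n) sc).
exact: (ec p [set p n] (discrete_set1 _)).
Qed.

Lemma near_sym_inv (p : sym N) (n : N) : nbhs p [set q : sym N | q^-1 n = p^-1 n].
Proof.
apply: filterS (near_sym p (p^-1 n)) => q /=; rewrite [p _]sym_invK => qn.
by rewrite -[in LHS]qn [LHS]sym_funK.
Qed.

Lemma continuous_to_sym (U : topologicalType) (f : U -> sym N) :
  (forall u n, \forall v \near u, f v n = f u n) -> continuous f.
Proof.
move=> fc; apply: continuous_initial; apply: continuous_ptws => n.
by apply: continuous_to_discrete => u; exact: fc.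
Qed.

End SymTopology.

Section PermGroupTheory.
Variables (N : countType) (P : permGroup N).
Implicit Types p q : set_type P.

Definition pg_one : set_type P := SigSub (mem_set (perm_set1 P)).

Definition pg_mul p q : set_type P :=
  SigSub (mem_set (perm_setM (set_mem (valP p)) (set_mem (valP q)))).

Definition pg_inv p : set_type P :=
  SigSub (mem_set (perm_setV (set_mem (valP p)))).

Fact pg_mulA : associative pg_mul.
Proof. by move=> p q r; apply: val_inj; exact: mulgA. Qed.
Fact pg_mul1 : left_id pg_one pg_mul.
Proof. by move=> p; apply: val_inj; exact: mul1g. Qed.
Fact pg_mulr1 : right_id pg_one pg_mul.
Proof. by move=> p; apply: val_inj; exact: mulg1. Qed.
Fact pg_mulV : left_inverse pg_one pg_inv pg_mul.
Proof. by move=> p; apply: val_inj; exact: mulVg. Qed.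
Fact pg_mulrV : right_inverse pg_one pg_inv pg_mul.
Proof. by move=> p; apply: val_inj; exact: mulgV. Qed.

HB.instance Definition _ :=
  isGroup.Build (set_type P) pg_mulA pg_mul1 pg_mulr1 pg_mulV pg_mulrV.

Lemma near_pg p (n : N) : nbhs p [set q : set_type P | val q n = val p n].
Proof.
have vc : continuous (val : set_type P -> sym N) by exact: initial_continuous.
exact: vc p _ (near_sym (val p) n).
Qed.

Lemma near_pg_inv p (n : N) : nbhs p [set q : set_type P | (val q)^-1 n = (val p)^-1 n].
Proof.
have vc : continuous (val : set_type P -> sym N) by exact: initial_continuous.
exact: vc p _ (near_sym_inv (val p) n).
Qed.

Lemma continuous_to_pg (U : topologicalType) (f : U -> set_type P) :
  (forall u n, \forall v \near u, val (f v) n = val (f u) n) -> continuous f.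
Proof. by move=> fc; apply: continuous_initial; exact: continuous_to_sym. Qed.

Fact pg_mul_continuous :
  continuous (fun x : set_type P * set_type P => x.1 * x.2).
Proof.
apply: continuous_to_pg => -[p q] n /=.
have c1 : continuous (@fst (set_type P) (set_type P)) by move=> ?; exact: cvg_fst.
have c2 : continuous (@snd (set_type P) (set_type P)) by move=> ?; exact: cvg_snd.
near=> v.
have e2 : val v.2 n = val q n by near: v; exact: (c2 (p, q) _ (near_pg q n)).
have e1 : val v.1 (val q n) = val p (val q n).
  by near: v; exact: (c1 (p, q) _ (near_pg p (val q n))).
by rewrite -e1 -e2.
Unshelve. all: by end_near. Qed.

Fact pg_inv_continuous : continuous (fun x : set_type P => x^-1).
Proof. by apply: continuous_to_pg => p n; exact: near_pg_inv. Qed.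

HB.instance Definition _ := isTopologicalGroup.Build (set_type P)
  pg_mul_continuous pg_inv_continuous.

End PermGroupTheory.

(* A separate constant, so that it carries the wreath product group law rather
   than the direct product law which MathComp attaches to pairs. *)
Definition wreath (N : countType) (P : permGroup N) (G : topologicalGroupType) :
  Type := set_type P * {ptws N -> G}.

HB.instance Definition _ (N : countType) (P : permGroup N)
    (G : topologicalGroupType) :=
  Topological.copy (wreath P G) (set_type P * {ptws N -> G})%type.

Section Wreath.
Variables (N : countType) (P : permGroup N) (G : topologicalGroupType).
Local Notation W := (wreath P G).

Definition wreath_one : W := (1, fun=> 1).

Definition wreath_mul (w2 w1 : W) : W :=
  (w2.1 * w1.1, fun n => w2.2 (val w1.1 n) * w1.2 n).

Definition wreath_inv (w : W) : W :=
  (w.1^-1, fun n => (w.2 ((val w.1)^-1 n))^-1).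

Fact wreath_mulA : associative wreath_mul.
Proof.
move=> w3 w2 w1; congr pair; first exact: mulgA.
by apply/funext => n /=; rewrite mulgA.
Qed.
Fact wreath_mul1 : left_id wreath_one wreath_mul.
Proof.
by case=> p g; congr pair; [exact: mul1g|apply/funext => n /=; exact: mul1g].
Qed.
Fact wreath_mulr1 : right_id wreath_one wreath_mul.
Proof.
by case=> p g; congr pair; [exact: mulg1|apply/funext => n /=; exact: mulg1].
Qed.
Fact wreath_mulV : left_inverse wreath_one wreath_inv wreath_mul.
Proof.
case=> p g; congr pair; first exact: mulVg.
apply/funext => n; change ((g ((val p)^-1 (val p n)))^-1 * g n = 1).
have -> : (val p)^-1 (val p n) = n by exact: sym_funK.
exact: mulVg.
Qed.
Fact wreath_mulrV : right_inverse wreath_one wreath_inv wreath_mul.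
Proof.
by case=> p g; congr pair; [exact: mulgV|apply/funext => n; exact: mulgV].
Qed.

HB.instance Definition _ :=
  isGroup.Build W wreath_mulA wreath_mul1 wreath_mulr1 wreath_mulV wreath_mulrV.

Lemma wreath_fst_continuous : continuous (fst : W -> set_type P).
Proof. by move=> ?; exact: cvg_fst. Qed.

Lemma wreath_snd_continuous (n : N) : continuous (fun w : W => w.2 n).
Proof.
have sc : continuous (snd : W -> {ptws N -> G}) by move=> ?; exact: cvg_snd.
exact (continuous_compose (@continuous_at_ptws N G n) sc).
Qed.

Lemma near_wreath_fst (w : W) n : nbhs w [set v : W | val v.1 n = val w.1 n].
Proof. exact: wreath_fst_continuous w _ (near_pg w.1 n). Qed.

Lemma near_wreath_fst_inv (w : W) n :
  nbhs w [set v : W | (val v.1)^-1 n = (val w.1)^-1 n].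
Proof. exact: wreath_fst_continuous w _ (near_pg_inv w.1 n). Qed.

Fact wreath_mul_continuous : continuous (fun x : W * W => x.1 * x.2).
Proof.
have c1 : continuous (@fst W W) by move=> ?; exact: cvg_fst.
have c2 : continuous (@snd W W) by move=> ?; exact: cvg_snd.
apply: continuous_pair.
  apply: (@continuous_op2 _ _ _ _ _ (fun x : W * W => x.1.1)
    (fun x : W * W => x.2.1) (@mulg_continuous (set_type P))).
  - exact (continuous_compose wreath_fst_continuous c1).
  - exact (continuous_compose wreath_fst_continuous c2).
apply: continuous_ptws => n.
apply: (@continuous_locally_constant _ _ _ (fun x : W * W => val x.2.1 n)
  (fun m (x : W * W) => x.1.2 m * x.2.2 n)) => [x|m].
  exact: c2 x _ (near_wreath_fst x.2 n).
apply: (@continuous_op2 _ _ _ _ _ (fun x : W * W => x.1.2 m)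
  (fun x : W * W => x.2.2 n) (@mulg_continuous G)).
- exact (continuous_compose (@wreath_snd_continuous m) c1).
- exact (continuous_compose (@wreath_snd_continuous n) c2).
Qed.

Fact wreath_inv_continuous : continuous (fun x : W => x^-1).
Proof.
apply: continuous_pair.
  exact (continuous_compose (@invg_continuous (set_type P)) wreath_fst_continuous).
apply: continuous_ptws => n.
apply: (@continuous_locally_constant _ _ _ (fun x : W => (val x.1)^-1 n)
  (fun m (x : W) => (x.2 m)^-1)) => [x|m]; first exact: near_wreath_fst_inv.
exact (continuous_compose (@invg_continuous G) (@wreath_snd_continuous m)).
Qed.

HB.instance Definition _ := isTopologicalGroup.Build W
  wreath_mul_continuous wreath_inv_continuous.

Variables (X : topologicalType) (a : continuousAction G X).

Definition jump_fun (w : W) (x : {ptws N -> X}) : {ptws N -> X} :=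
  fun n => a (w.2 ((val w.1)^-1 n)) (x ((val w.1)^-1 n)).

Fact jump_fun1 x : jump_fun 1 x = x.
Proof. by apply/funext => n; exact: act1. Qed.

Fact jump_funM v w x : jump_fun (v * w) x = jump_fun v (jump_fun w x).
Proof.
apply/funext => n; rewrite /jump_fun /= -actM; congr (a (v.2 _ * _) _).
exact: sym_invK.
Qed.

Fact jump_fun_continuous :
  continuous (fun wx : W * {ptws N -> X} => jump_fun wx.1 wx.2).
Proof.
have c1 : continuous (@fst W {ptws N -> X}) by move=> ?; exact: cvg_fst.
have c2 : continuous (@snd W {ptws N -> X}) by move=> ?; exact: cvg_snd.
apply: continuous_ptws => n.
apply: (@continuous_locally_constant _ _ _
  (fun wx : W * {ptws N -> X} => (val wx.1.1)^-1 n)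
  (fun m (wx : W * {ptws N -> X}) => a (wx.1.2 m) (wx.2 m))) => [x|m].
  exact: c1 x _ (near_wreath_fst_inv x.1 n).
apply: (@continuous_op2 _ _ _ _ _ (fun wx : W * {ptws N -> X} => wx.1.2 m)
  (fun wx : W * {ptws N -> X} => wx.2 m) (@act_continuous _ _ a)).
- exact (continuous_compose (@wreath_snd_continuous m) c1).
- exact (continuous_compose (@continuous_at_ptws N X m) c2).
Qed.

(* The P-jump of a. *)
Definition jump : continuousAction W {ptws N -> X} :=
  ContinuousAction jump_fun1 jump_funM jump_fun_continuous.

End Wreath.

(* Main.v *)
Require Import Defs.
From HB Require Import structures.
From mathcomp Require Import all_boot all_order all_algebra.
From mathcomp Require Import all_classical all_reals topology.

Set Implicit Arguments.
Unset Strict Implicit.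
Unset Printing Implicit Defensive.

Local Open Scope classical_set_scope.

(** Two elements x and y of X^N are joined by an edge of the unbalanced graph as
soon as all their coordinates have dense G-orbits and they agree on a set A of
indices into which P can move every finite set.  Given a neighborhood V of the
identity and an open set U, only finitely many indices F matter; moving F into A
by some p in P and then acting coordinatewise, x and y are carried into U by one
and the same group element, and their images agree on F.  Outside F the set V
allows arbitrary elements of G, and density of the orbits of the coordinates lets
a V-translate of either image approximate the other one
([unbalanced_agree]).

B.H. Neumann's lemma says that, all P-orbits being infinite, any finite set can be
moved off any other one ([neumann]); hence N contains a set A such that both A and
its complement have the moving property ([absorbing_split]).  Write x = (x', x'')
for the restrictions of x to A and to its complement.  Then
   (x', x''),  (x', z''),  (y', z''),  (y', y'')
is a path for every z, as soon as all coordinates have dense orbits, which is a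
comeager condition ([dense_orbit_comeager_ptws]).  The path stays inside a given
comeager C for a suitable z: by the Kuratowski-Ulam theorem for X^N seen as the
product of X^A and of X^(N \ A) ([comeager_splice]), for comeagerly many x the set
of z such that (x', z'') is in C is comeager, and by the Baire category theorem
([polish_ptws_baire]) the two comeager sets of such z attached to x and to y
meet. *)

(** * Comeager sets *)

Definition baire_space (T : topologicalType) : Prop :=
  forall U : nat -> set T, (forall k, open (U k) /\ dense (U k)) ->
    dense (\bigcap_k U k).

Section ComeagerSets.
Variable T : topologicalType.
Implicit Types A B C : set T.

Lemma denseS A B : A `<=` B -> dense A -> dense B.
Proof.
by move=> AB dA O O0 oO; have [x [Ox Ax]] := dA O O0 oO; exists x; split=> //; exact: AB.
Qed.

Lemma denseT : dense [set: T].
Proof. by move=> O [x Ox] _; exists x. Qed.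

Lemma interior_closureC A : (closure (~` A))° = set0 <-> dense A° .
Proof.
rewrite closure_setC; split=> [A0 O [x Ox] oO|dA].
  apply: contrapT => OA; have : (~` A°)° x.
    rewrite /interior nbhsE; exists O; first by split.
    by move=> y Oy Ay; apply: OA; exists y.
  by rewrite A0.
apply/seteqP; split=> // x xA.
have [y [/interior_subset nAy Ay]] := dA _ (ex_intro _ x xA) (open_interior _).
exact: nAy Ay.
Qed.

Lemma comeagerP C :
  comeager C <-> exists2 U : nat -> set T,
    (forall k, open (U k) /\ dense (U k)) & \bigcap_k U k `<=` C.
Proof.
split=> [[F ndF CF]|[U odU UC]].
  exists (fun k => (~` F k)°) => [k|x Ux].
    by split; [exact: open_interior|apply/interior_closureC; rewrite setCK; exact: ndF].
  apply: contrapT => /CF[k _ Fkx].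
  exact: interior_subset (Ux k Logic.I) Fkx.
exists (fun k => ~` U k) => [k|x nCx].
  rewrite /nowhere_dense; apply/interior_closureC.
  by have [oU dU] := odU k; rewrite (interior_id _).1.
apply: contrapT => nUx; apply: nCx; apply: UC => k _.
by apply: contrapT => nUkx; apply: nUx; exists k.
Qed.

Lemma comeager_open_dense A : open A -> dense A -> comeager A.
Proof. by move=> oA dA; apply/comeagerP; exists (fun=> A) => // x /(_ 0%N Logic.I). Qed.

Lemma comeagerS A B : A `<=` B -> comeager A -> comeager B.
Proof.
by move=> AB /comeagerP[U odU UA]; apply/comeagerP; exists U => // x /UA /AB.
Qed.

Lemma comeager_bigcap (I : countType) (A : I -> set T) :
  (forall i, comeager (A i)) -> comeager (\bigcap_i A i).
Proof.
move=> cA; have /choice[U UP] : forall i, exists U : nat -> set T,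
    (forall k, open (U k) /\ dense (U k)) /\ \bigcap_k U k `<=` A i.
  by move=> i; have /comeagerP[U ? ?] := cA i; exists U.
pose V n := if unpickle n is Some ik then U ik.1 ik.2 else [set: T].
apply/comeagerP; exists V => [n|x Vx i _].
  rewrite /V; case: unpickle => [[i k]|]; first exact: (UP i).1.
  by split; [exact: openT|exact: denseT].
by apply: (UP i).2 => k _; have := Vx (pickle (i, k)) Logic.I; rewrite /V pickleK.
Qed.

Lemma comeagerI A B : comeager A -> comeager B -> comeager (A `&` B).
Proof.
move=> cA cB.
apply: (comeagerS _ (@comeager_bigcap bool (fun b => if b then A else B) _)).
  by move=> x ABx; split; [exact: (ABx true)|exact: (ABx false)].
by case.
Qed.

Lemma baire_comeager_dense C : baire_space T -> comeager C -> dense C.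
Proof. by move=> bT /comeagerP[U odU UC]; apply: denseS UC _; exact: bT. Qed.

End ComeagerSets.

(** * Second countable spaces, Baire spaces and Polish powers *)

Section SecondCountable.
Variable T : topologicalType.

Lemma second_countable_range (I : countType) (B : I -> set T) :
  (forall i, open (B i)) ->
  (forall x O, nbhs x O -> exists2 i, B i x & B i `<=` O) ->
  @second_countable T.
Proof.
move=> oB nB; exists (range B).
  by apply: sub_countable (card_image_le _ _) _; exact: countableP.
split=> [_ [i _ <-]|x O /nB[i Bix BiO]]; first exact: oB.
by exists (B i) => //; split=> //; exists i.
Qed.

(** Choosing an injection of the basis into nat and taking the union of each of
its fibers enumerates the basis, the indices outside the image giving set0; this
avoids a case distinction on whether the basis is empty. *)
Lemma second_countable_seq : @second_countable T ->
  exists2 B : nat -> set T, (forall k, open (B k)) &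
    forall x O, nbhs x O -> exists2 k, B k x & B k `<=` O.
Proof.
move=> [BB /countable_injP[f f_inj] [oBB nBB]].
exists (fun k => \bigcup_(V in [set V | BB V /\ f V = k]) V) => [k|x O].
  by apply: bigcup_open => V [/oBB].
move=> /nBB[V [BV Vx] VO]; exists (f V); first by exists V.
move=> y [W [BW fWV] Wy]; apply: VO.
by rewrite -(f_inj W V) ?inE.
Qed.

End SecondCountable.

Section UniformSpaces.
Variable M : uniformType.

(** The basis consists of the sections of the basic entourages at the points of a
countable dense set.  Two successive halvings are needed: one to put x in the
interior of the section at d, another to keep that section inside O. *)
Lemma separable_second_countable :
  separable M -> countable_uniformity M -> @second_countable M.
Proof.
move=> [D /countable_injP[f f_inj] dD] /countable_uniformityP[e e_base e_ent].
pose B (ik : nat * nat) :=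
  \bigcup_(d in [set d | D d /\ f d = ik.1]) (xsection (e ik.2) d)°.
apply: (@second_countable_range M _ B) => [[i k]|x O].
  by apply: bigcup_open => d _; exact: open_interior.
rewrite -nbhs_entourageE => -[E entE EO].
pose E' := split_ent E; have entE' : entourage E' by exact: entourage_split_ent.
have [k ekE'] := e_base _ entE'.
pose G := split_ent (e k); have entG : entourage G by exact: entourage_split_ent.
have entEG : entourage (E' `&` G^-1)%relation by apply: filterI => //; exact: entourage_inv.
have [oH Hx] := open_nbhs_entourage x entEG.
have [d [/interior_subset /xsectionP[E'xd Gdx] Dd]] := dD _ (ex_intro _ x Hx) oH.
exists (f d, k).
  exists d => //; rewrite /interior -nbhs_entourageE; exists G => // y /xsectionP Gxy.
  by apply/xsectionP; apply: (entourage_split x) => //; exact: e_ent.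
move=> y [d' [Dd' fd']] /interior_subset /xsectionP.
rewrite (f_inj d' d) ?inE// => /ekE' E'dy.
by apply: EO; apply/xsectionP; exact: (entourage_split d).
Qed.

(** The usual nested construction: each open set S k.+1 is e k-small and has its
closure inside S k and U k, so that the S k generate a Cauchy filter, whose limit
lies in all the closures. *)
Lemma complete_baire :
  complete_space M -> countable_uniformity M -> baire_space M.
Proof.
move=> cM /countable_uniformityP[e e_base e_ent] U odU O0 O0n oO0.
pose good (O : set M) := open O /\ O !=set0.
have step (kO : nat * set M) : exists O', good kO.2 ->
    [/\ good O', closure O' `<=` kO.2 `&` U kO.1 &
        forall y z, O' y -> O' z -> e kO.1 (y, z)].
  case: kO => k O; have [[oO On]|nO] := pselect (good O); last by exists O => /nO.
  have [oU dU] := odU k; have [x [Ox Ux]] := dU O On oO.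
  have : nbhs x (O `&` U k) by apply: open_nbhs_nbhs; split; [exact: openI|].
  move=> /uniform_regular[A nA AOU].
  pose E := split_ent (e k).
  have entE : entourage E by apply: entourage_split_ent; exact: e_ent.
  have nE : nbhs x (A `&` xsection (E `&` E^-1)%relation x).
    apply: filterI => //; apply: nbhs_entourage; exact: entourage_invI.
  exists (A `&` xsection (E `&` E^-1)%relation x)° => _; split.
  - by split; [exact: open_interior|exists x].
  - apply: subset_trans (closureS _) AOU.
    by apply: subset_trans (@interior_subset _ _) _; exact: subIsetl.
  - move=> y z /interior_subset[_ /xsectionP[_ Eyx]].
    move=> /interior_subset[_ /xsectionP[Exz _]].
    by apply: (entourage_split x) => //; exact: e_ent.
have [next nextP] := choice step.
pose S := fix S n := if n is k.+1 then next (k, S k) else O0.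
have gS n : good (S n).
  by elim: n => [//|n IH] /=; have [] := nextP (n, S n) IH.
have S_closure n : closure (S n.+1) `<=` S n `&` U n by have [] := nextP (n, S n) (gS n).
have S_small n y z : S n.+1 y -> S n.+1 z -> e n (y, z).
  by have [_ _] := nextP (n, S n) (gS n); exact.
have S_decr m n : (m <= n)%N -> S n `<=` S m.
  elim: n => [|n IH]; first by rewrite leqn0 => /eqP->.
  rewrite leq_eqVlt ltnS => /predU1P[->//|/IH]; apply: subset_trans.
  by move=> y /subset_closure /S_closure[].
pose F := filter_from setT S.
have FF : ProperFilter F.
  apply: filter_from_proper => [|n _]; last exact: (gS n).2.
  apply: filter_fromT_filter; first by exists 0%N.
  move=> i j; exists (maxn i j) => y Sy.
  by split; apply: S_decr Sy; rewrite ?leq_maxl ?leq_maxr.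
have [|x Fx] := cM F FF.
  move=> E /e_base[k ekE]; exists (S k.+1, S k.+1).
    by split; exists k.+1.
  by move=> [y z] [/= Sy Sz]; apply: ekE; exact: S_small.
have clx n : closure (S n) x.
  move=> W /Fx[m _ SW]; have [y Sy] := (gS (maxn m n)).2.
  exists y; split; last apply: SW; apply: S_decr Sy; rewrite ?leq_maxl ?leq_maxr//.
exists x; split; first by have [] := S_closure 0%N x (clx 1%N).
by move=> n _; have [] := S_closure n x (clx n.+1).
Qed.

End UniformSpaces.

Lemma homeomorphic_baire (S T : topologicalType) :
  homeomorphic S T -> baire_space T -> baire_space S.
Proof.
move=> [f [g [fK gK fc gc]]] bT U odU O [x Ox] oO.
have [| | |y [Oy Uy]] := bT (fun k => g @^-1` U k) _ (g @^-1` O).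
- move=> k; have [oU dU] := odU k; split; first exact: (continuousP g).1.
  move=> W [y Wy] oW; have [|z [Wz Uz]] := dU (f @^-1` W) _ ((continuousP f).1 fc _ oW).
    by exists (g y); rewrite /= gK.
  by exists (f z); split=> //=; rewrite fK.
- by exists (f x); rewrite /= fK.
- exact: (continuousP g).1.
- by exists (g y); split.
Qed.

Lemma homeomorphic_second_countable (S T : topologicalType) :
  homeomorphic S T -> @second_countable T -> @second_countable S.
Proof.
move=> [f [g [fK gK fc gc]]] /second_countable_seq[B oB nB].
apply: (@second_countable_range _ _ (fun k => f @^-1` B k)) => [k|x O nO].
  exact: (continuousP f).1.
have [|k Bk BO] := nB (f x) (g @^-1` O); first by apply: gc; rewrite fK.
by exists k => // y /BO; rewrite /= fK.
Qed.

Lemma homeomorphic_separable (S T : topologicalType) :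
  homeomorphic S T -> separable S -> separable T.
Proof.
move=> [f [g [fK gK fc gc]]] [D cD dD]; exists (f @` D).
  by apply: sub_countable cD; exact: card_image_le.
move=> O [y Oy] oO.
have [|x [Ox Dx]] := dD (f @^-1` O) _ ((continuousP f).1 fc _ oO).
  by exists (g y); rewrite /= gK.
by exists (f x); split=> //; exists x.
Qed.

Lemma homeomorphic_ptws (N : eqType) (S T : topologicalType) :
  homeomorphic S T -> homeomorphic {ptws N -> S} {ptws N -> T}.
Proof.
move=> [f [g [fK gK fc gc]]].
exists (fun z n => f (z n)), (fun z n => g (z n)); split=> [z|z| |].
- by apply/funext => n; exact: fK.
- by apply/funext => n; exact: gK.
- apply: continuous_ptws => n.
  exact (continuous_compose fc (@continuous_at_ptws N S n)).
- apply: continuous_ptws => n.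
  exact (continuous_compose gc (@continuous_at_ptws N T n)).
Qed.

Section PointwiseTopology.
Variables (N : eqType) (X : topologicalType).

(** The sets containing a box around w form a filter; it converges to w
coordinatewise, hence in the product topology. *)
Lemma nbhs_ptws_box (w : {ptws N -> X}) (O : set {ptws N -> X}) : nbhs w O ->
  exists (F : seq N) (U : N -> set X), (forall n, open_nbhs (w n) (U n)) /\
    forall z : {ptws N -> X}, (forall n, n \in F -> U n (z n)) -> O z.
Proof.
pose box (FU : seq N * (N -> set X)) : set {ptws N -> X} :=
  [set z | forall n, n \in FU.1 -> FU.2 n (z n)].
pose B := filter_from [set FU : seq N * (N -> set X) |
  forall n, open_nbhs (w n) (FU.2 n)] box.
have FB : Filter B.
  apply: filter_from_filter.
    by exists ([::], fun=> setT) => n /=; split; [exact: openT|].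
  move=> [F U] [F' U'] /= wU wU'; exists (F ++ F', fun n => U n `&` U' n).
    by move=> n; exact: open_nbhsI.
  move=> z zUU'; split=> n nF; have [] := zUU' n;
    by rewrite /= ?mem_cat ?nF ?orbT.
suff Bw : B --> w by move=> /Bw[[F U] /= wU UO]; exists F, U.
apply/cvg_sup => n; apply: initial_cvg => V.
rewrite nbhsE => -[W [oW Ww] WV].
exists ([:: n], fun m => if m == n then W else setT) => [m /=|z /(_ n)].
  by case: eqP => [->|_]; split=> //; exact: openT.
by rewrite /= mem_head eqxx => /(_ isT) /WV.
Qed.

Lemma open_ptws_box (I : eqType) (s : seq I) (pos : I -> N) (U : I -> set X) :
  (forall i, open (U i)) ->
  open [set z : {ptws N -> X} | forall i, i \in s -> U i (z (pos i))].
Proof.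
move=> oU; elim: s => [|j s IH].
  by rewrite (_ : [set _ | _] = setT); [exact: openT|apply/seteqP].
rewrite (_ : [set _ | _] = [set z : {ptws N -> X} | U j (z (pos j))] `&`
    [set z : {ptws N -> X} | forall i, i \in s -> U i (z (pos i))]).
  apply: openI => //.
  exact: (continuousP _).1 (@continuous_at_ptws N X (pos j)) _ (oU j).
apply/seteqP; split=> z.
  by move=> zU; split=> [|i si]; apply: zU; rewrite inE ?eqxx ?si ?orbT.
by move=> [zj zs] i; rewrite inE => /predU1P[->//|]; exact: zs.
Qed.

End PointwiseTopology.

Lemma second_countable_ptws (N : countType) (X : topologicalType) :
  @second_countable X -> @second_countable {ptws N -> X}.
Proof.
move=> /second_countable_seq[B oB nB].
pose box (s : seq (N * nat)) : set {ptws N -> X} :=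
  [set z | forall nk, nk \in s -> B nk.2 (z nk.1)].
apply: (@second_countable_range _ _ box) => [s|w O].
  exact: (@open_ptws_box _ _ _ s fst (fun nk => B nk.2)).
move=> /nbhs_ptws_box[F [U [wU UO]]].
have /choice[k kP] n : exists k, B k (w n) /\ B k `<=` U n.
  by have [k] := nB _ _ (open_nbhs_nbhs (wU n)); exists k.
exists [seq (n, k n) | n <- F] => [_ /mapP[n _ ->]|z zs]; first exact: (kP n).1.
by apply: UO => n nF; apply: (kP n).2; apply: (zs (n, k n)); exact: map_f.
Qed.

(** Uniform continuity of the projections, which makes the images of a Cauchy
filter Cauchy in [complete_ptws]. *)
Lemma entourage_proj (N : eqType) (M : uniformType) (n : N) (E : set (M * M)) :
  entourage E ->
  entourage [set zz : {ptws N -> M} * {ptws N -> M} | E (zz.1 n, zz.2 n)].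
Proof.
move=> entE; set En := [set _ | _].
pose ent_of (p : {classic N} * set ({ptws N -> M} * {ptws N -> M})) :=
  `[< @entourage (initial_topology (@proj N (fun=> M) p.1)) p.2 >].
have entEn : ent_of (n, En) by apply/asboolP; exists E.
exists En => //; exact: (@finI_from1 _ _ setT _ (exist ent_of (n, En) entEn)).
Qed.

Lemma complete_ptws (N : eqType) (M : uniformType) :
  complete_space M -> complete_space {ptws N -> M}.
Proof.
move=> cM F FF cF.
have cv n : exists x : M, (fun z : {ptws N -> M} => z n) @ F --> x.
  apply: cM => E /(entourage_proj n) /cF[[A B] /= [FA FB] ABE].
  exists ((@^~ n) @` A, (@^~ n) @` B) => /=.
    by split; [apply: filterS FA|apply: filterS FB] => z ?; exists z.
  by move=> [_ _] [/= [z Az <-] [t Bt <-]]; exact: (ABE (z, t)).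
have [x xP] := choice cv.
by exists x; apply/cvg_sup => n; apply: initial_cvg; exact: xP.
Qed.

Section Polish.
Variables (R : realType) (N : countType) (X : topologicalType).

Lemma polish_second_countable : polish R X -> @second_countable X.
Proof.
move=> [sX [M _ XM]]; apply: homeomorphic_second_countable (XM) _.
apply: separable_second_countable; first exact: homeomorphic_separable XM sX.
exact: countable_uniformity_metric.
Qed.

Lemma polish_ptws_baire : polish R X -> baire_space {ptws N -> X}.
Proof.
move=> [_ [M cM XM]]; apply: homeomorphic_baire (homeomorphic_ptws N XM) _.
apply: complete_baire; first exact: complete_ptws.
exact: (@countable_uniformity_metric R {ptws N -> M}).
Qed.
End Polish.

(** * Kuratowski-Ulam for X^N split along a set of indices *)

Section Splice.
Variables (N : eqType) (X : topologicalType) (A : set N).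
Implicit Types x z : {ptws N -> X}.

(** X^N is viewed as the product of X^A and X^(N \ A) without introducing these
two spaces. *)
Definition splice x z : {ptws N -> X} := fun n => if `[< A n >] then x n else z n.

Lemma splice_in x z n : A n -> splice x z n = x n.
Proof. by move=> An; rewrite /splice asboolT. Qed.

Lemma splice_out x z n : ~ A n -> splice x z n = z n.
Proof. by move=> nAn; rewrite /splice asboolF. Qed.

(** The map (x, z) |-> (splice x z, splice z x) is an involution. *)
Lemma splice_splice x z : splice (splice x z) (splice z x) = x.
Proof. by apply/funext => n; rewrite /splice; case: `[< A n >]. Qed.

Lemma splice_continuousl z : continuous (splice^~ z).
Proof.
apply: continuous_ptws => n; rewrite /splice; case: `[< A n >].
  exact: (@continuous_at_ptws N X n).
  exact: cst_continuous.
Qed.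

Lemma splice_continuousr x : continuous (splice x).
Proof.
apply: continuous_ptws => n; rewrite /splice; case: `[< A n >].
  exact: cst_continuous.
exact: (@continuous_at_ptws N X n).
Qed.

(** Since the involution above is continuous, the image of V `*` W under it is
open; fixing the second component at v leaves an open set of first components
splice x z with x in V and z in W, and this set meets O. *)
Lemma dense_splice (O V W : set {ptws N -> X}) :
  open O -> dense O -> open V -> V !=set0 -> open W -> W !=set0 ->
  exists x z, [/\ V x, W z & O (splice x z)].
Proof.
move=> oO dO oV [x0 Vx0] oW [z0 Wz0].
pose v := splice z0 x0.
have [| |u [[Vu Wu] Ou]] := dO ((splice^~ v) @^-1` V `&` (splice v) @^-1` W).
- exists (splice x0 z0); split; first by rewrite /= splice_splice.
  by rewrite /= /v splice_splice.
- apply: openI; apply: (continuousP _).1 => //.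
    exact: splice_continuousl.
  exact: splice_continuousr.
by exists (splice u v), (splice v u); rewrite splice_splice.
Qed.

(** The Kuratowski-Ulam theorem.  It is enough to treat a dense open O.  All
sections of O are open, and the section at x is dense if and only if it meets each
of the countably many nonempty basic sets B j; for a fixed j the points x with this
property form an open set, dense by [dense_splice]. *)
Lemma comeager_splice (C : set {ptws N -> X}) :
  @second_countable {ptws N -> X} -> comeager C ->
  comeager [set x | comeager [set z | C (splice x z)]].
Proof.
move=> /second_countable_seq[B oB nB] /comeagerP[U odU UC].
pose E (kj : nat * nat) : set {ptws N -> X} :=
  [set x | B kj.2 !=set0 -> exists2 z, B kj.2 z & U kj.1 (splice x z)].
have cE kj : comeager (E kj).
  case: kj => k j; have [oU dU] := odU k.
  have [Bj|nBj] := pselect (B j !=set0); last first.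
    have -> : E (k, j) = setT by apply/seteqP; split=> // x _ /nBj.
    exact: comeager_open_dense openT (@denseT _).
  have -> : E (k, j) = \bigcup_(z in B j) ((splice^~ z) @^-1` U k).
    by apply/seteqP; split=> [x /(_ Bj)[z Bz Uz]|x [z Bz Uz] _]; exists z.
  apply: comeager_open_dense.
    apply: bigcup_open => z _; apply: (continuousP _).1 oU.
    exact: splice_continuousl.
  move=> O O0 oO; have [x [z [Ox Bz Uxz]]] := dense_splice oU dU oO O0 (oB j) Bj.
  by exists x; split=> //; exists z.
apply: comeagerS (comeager_bigcap cE) => x Ex.
apply: (@comeagerS _ (\bigcap_k (splice x @^-1` U k))).
  by move=> z Uz; apply: UC.
apply: (@comeager_bigcap _ nat) => k; have [oU dU] := odU k.
apply: comeager_open_dense; first by apply: (continuousP _).1 oU; exact: splice_continuousr.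
move=> O [w Ow] oO; have [j Bw BO] := nB w O (open_nbhs_nbhs (conj oO Ow)).
have [|z Bz Uz] := Ex (k, j) Logic.I; first by exists w.
by exists z; split=> //; exact: BO.
Qed.

End Splice.

(** * Points with dense orbits *)

Section DenseOrbits.
Variables (G : topologicalGroupType) (X : topologicalType).
Variable a : continuousAction G X.

Lemma act_continuousr g : continuous (a g).
Proof.
apply: (@continuous_op2 _ _ _ _ (fun g x => a g x) (fun=> g) id (@act_continuous _ _ a)).
  exact: cst_continuous.
by move=> x; exact: cvg_id.
Qed.

Lemma action_orbit_act g x : action_orbit a (a g x) = action_orbit a x.
Proof.
apply/seteqP; split=> _ [h _ <-]; first by exists (h * g)%g => //; rewrite actM.
by exists (h * g^-1)%g => //; rewrite -actM -mulgA mulVg mulg1.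
Qed.

(** The saturation of a nonempty basic open set is open and contains the given
dense orbit, hence it is dense.  Preimages of dense sets under a projection are
dense, as a single coordinate can be modified inside an open set. *)
Lemma dense_orbit_comeager_ptws (N : countType) :
  @second_countable X -> (exists x, dense (action_orbit a x)) ->
  comeager [set z : {ptws N -> X} | forall n, dense (action_orbit a (z n))].
Proof.
move=> /second_countable_seq[B oB nB] [x0 dx0].
pose S j := [set x | B j !=set0 -> B j `&` action_orbit a x !=set0].
apply: (@comeagerS _ (\bigcap_nj [set z : {ptws N -> X} | S nj.2 (z nj.1)])).
  move=> z Sz n O [w Ow] oO.
  have [j Bw BO] := nB w O (open_nbhs_nbhs (conj oO Ow)).
  have [|y [By zy]] := Sz (n, j) Logic.I; first by exists w.
  by exists y; split=> //; exact: BO.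
apply: (@comeager_bigcap _ (N * nat)%type) => -[n j] /=.
have oS : open (S j).
  have [Bj|nBj] := pselect (B j !=set0); last first.
    have -> : S j = setT by apply/seteqP; split=> // x _ /nBj.
    exact: openT.
  have -> : S j = \bigcup_g (a g @^-1` B j).
    apply/seteqP; split=> [x /(_ Bj)[y [By [g _ gx]]]|x [g _ Bg] _].
      by exists g => //=; rewrite gx.
    by exists (a g x); split=> //; exists g.
  apply: bigcup_open => g _; apply: (continuousP _).1 (oB j).
  exact: act_continuousr.
apply: comeager_open_dense.
  exact: (continuousP _).1 (@continuous_at_ptws N X n) _ oS.
move=> O [z Oz] oO.
pose d : X -> {ptws N -> X} := @dfwith N (fun=> X) z n.
have dc : continuous d by exact: (@dfwith_continuous N (fun=> X) z n).
have [||_ [/[swap] [[g _ <-]] Od]] := dx0 (d @^-1` O).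
- exists (z n) => /=; rewrite (_ : d _ = z)//.
  by apply/funext => m; rewrite /d; case: dfwithP.
- exact: (continuousP d).1 dc _ oO.
exists (d (a g x0)); split=> //=; rewrite /d dfwithin /S /= => B0.
by rewrite action_orbit_act; exact: dx0.
Qed.

End DenseOrbits.

(** * Neumann's lemma *)

Section Neumann.
Variables (N : countType) (P : permGroup N).
Hypothesis P_orbit_infinite : forall n, infinite_set [set p n | p in perm_set P].

(** A form of B.H. Neumann's lemma on coverings of a group by cosets: P is not
covered by finitely many of the cosets {p | p a = b} of point stabilizers.  The
induction removes one stabilizer at a time.  As the orbit of a is infinite, some
coset {p | p a = q a} does not appear in T; were P covered, it would be covered by
the cosets of T for the other points.  A nonempty coset {p | p a = b} with (a, b) in T
is a left translate of it, so it can be replaced by translates of these cosets,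
which gives the list T''. *)
Lemma neumann_avoid (A : seq N) (T : seq (N * N)) :
  {subset map fst T <= A} ->
  exists2 p, perm_set P p & forall ab, ab \in T -> p ab.1 <> ab.2.
Proof.
elim: A T => [|a A IH] T TA.
  exists 1%g; first exact: perm_set1.
  by move=> ab /(map_f fst) /TA.
have [q Pq qT] : exists2 q, perm_set P q & (a, q a) \notin T.
  apply: contrapT => nq; apply: (@P_orbit_infinite a).
  apply: (@sub_finite_set _ _ [set` map snd T]); last exact: finite_seq.
  move=> _ [q Pq <-] /=; apply/mapP; exists (a, q a) => //.
  by apply: contrapT => /negP qT; apply: nq; exists q.
(* A representative of the coset {p | p a = b}, when this coset is not empty. *)
have /choice[r rP] b : exists r, perm_set P r /\
    forall p, perm_set P p -> p a = b -> r a = b.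
  have [[p Pp <-]|nb] := pselect (exists2 p, perm_set P p & p a = b).
    by exists p.
  exists 1%g; split=> [|p Pp pab]; first exact: perm_set1.
  by exfalso; apply: nb; exists p.
pose T' := [seq ab <- T | ab.1 != a].
pose T'' := T' ++ [seq (bcd.2.1, r bcd.1 ((q^-1)%g bcd.2.2)) |
                     bcd <- allpairs pair (map snd T) T'].
have [|p Pp pT] := IH T''.
  move=> c /mapP[[c' d] + ->] /=; rewrite mem_cat => /orP[].
    rewrite mem_filter /= => /andP[c'a /(map_f fst)/TA].
    by rewrite in_cons /= (negPf c'a).
  move=> /mapP[[b [c1 d1]] /allpairsP[[b1 cd] [/= _ cdT [_ e1]]] [-> _]].
  move: cdT; rewrite -e1 mem_filter /= => /andP[c'a /(map_f fst)/TA].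
  by rewrite in_cons /= (negPf c'a).
(* If p lies in one of the cosets of T, the construction of T'' forces it to be
   {p | p a = b}; then p is translated back to the missing coset. *)
have [[ab abT pab]|np] := pselect (exists2 ab, ab \in T & p ab.1 = ab.2); last first.
  by exists p => // ab abT pab; apply: np; exists ab.
case: ab abT pab => c b /= cbT pcb.
have ca : c = a.
  apply: contrapT => /eqP ca; apply: (pT (c, b)) => //.
  by rewrite mem_cat mem_filter /= ca cbT.
subst c.
have rba : sym_inv (r b) b = a.
  by rewrite -[X in sym_inv _ X]((rP b).2 p Pp pcb) sym_funK.
exists (q * (r b)^-1 * p)%g.
  apply: perm_setM => //; apply: perm_setM => //; apply: perm_setV; exact: (rP b).1.
move=> [c d] cdT /=; have [ca|ca] := eqVneq c a.
  by rewrite ca pcb rba => qad; move: qT; rewrite qad -ca cdT.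
move=> qd; apply: (pT (c, r b ((q^-1)%g d))).
  rewrite mem_cat; apply/orP; right; apply/mapP; exists (b, (c, d)) => //.
  apply: allpairs_f; first exact: (map_f snd cbT).
  by rewrite mem_filter ca.
by rewrite /= -qd sym_funK sym_invK.
Qed.

Lemma neumann (A B : seq N) :
  exists2 p, perm_set P p & forall n, n \in A -> p n \notin B.
Proof.
have [|p Pp pAB] := @neumann_avoid A (allpairs pair A B).
  by move=> c /mapP[_ /allpairsP[[a b] [/= aA _ ->]] ->].
exists p => // n nA; apply/negP => pnB.
exact: (pAB (n, p n) (allpairs_f pair nA pnB)).
Qed.

Definition absorbing (A : set N) : Prop := forall F : seq N,
  exists2 p, perm_set P p & forall n, n \in F -> A (p n).

(** All pairs (F, b) of a finite set and a boolean are enumerated, and the finite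
sets are moved one after the other to pairwise disjoint places: A collects the
images of those marked true, and the images of those marked false avoid A. *)
Lemma absorbing_split : exists A : set N, absorbing A /\ absorbing (~` A).
Proof.
have /choice[nu nuP] (FE : seq N * seq N) : exists p, perm_set P p /\
    forall n, n \in FE.1 -> p n \notin FE.2.
  by have [p] := neumann FE.1 FE.2; exists p.
pose Fb k : seq N * bool := odflt ([::], true) (unpickle k).
pose F k := (Fb k).1.
(* E k collects the images chosen before stage k. *)
pose E := fix E k :=
  if k is k'.+1 then E k' ++ map (nu (F k', E k')) (F k') else [::].
pose p k := nu (F k, E k).
have Ele k l : (k <= l)%N -> {subset E k <= E l}.
  elim: l => [|l IH]; first by rewrite leqn0 => /eqP->.
  rewrite leq_eqVlt ltnS => /predU1P[->//|/IH EE] n /EE.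
  by rewrite /= mem_cat => ->.
have pE k l n m : (k < l)%N -> n \in F k -> m \in F l -> p k n <> p l m.
  move=> kl nk ml pp; have /negP[] := (nuP (F l, E l)).2 m ml.
  rewrite -/(p l) -pp; apply: (Ele k.+1) => //=.
  by rewrite mem_cat; apply/orP; right; exact: map_f.
have p_inj k l n m : n \in F k -> m \in F l -> p k n = p l m -> k = l.
  move=> nk ml pp; case: (ltngtP k l) => // kl; exfalso.
    exact: pE kl nk ml pp.
  exact: pE kl ml nk (esym pp).
exists [set n | exists k m, [/\ m \in F k, (Fb k).2 & n = p k m]]; split=> H.
  exists (p (pickle (H, true))); first exact: (nuP _).1.
  by move=> n nH; exists (pickle (H, true)), n; rewrite /F /Fb pickleK.
have FH : F (pickle (H, false)) = H by rewrite /F /Fb pickleK.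
exists (p (pickle (H, false))); first exact: (nuP _).1.
move=> n nH [k [m [mk bk]]]; rewrite -FH in nH => /(p_inj _ _ _ _ nH mk) kE.
by move: bk; rewrite -kE /Fb pickleK.
Qed.

End Neumann.

(** * Edges of the unbalanced graph of the jump *)

Section Jump.
Variables (N : countType) (P : permGroup N) (G : topologicalGroupType).
Variables (X : topologicalType) (a : continuousAction G X).
Implicit Types x y : {ptws N -> X}.

Lemma nbhs1_wreath (V : set (wreath P G)) : nbhs (1%g : wreath P G) V ->
  exists F : seq N, forall g : {ptws N -> G},
    (forall n, n \in F -> g n = 1%g) -> V (1%g, g).
Proof.
move=> [[V1 V2] /= [V1n V2n] V12].
have [F [U [oU UV]]] := nbhs_ptws_box V2n.
exists F => g gF; apply: (V12 (1%g, g)); split; first exact: nbhs_singleton V1n.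
by apply: UV => n nF /=; rewrite gF//; exact: (oU n).2.
Qed.

(** On F nothing has to move; at each of the other coordinates the dense orbit of
x n comes as close to y n as required. *)
Lemma closure_wreath_translate (F : seq N) (V : set (wreath P G)) x y :
  (forall g : {ptws N -> G}, (forall n, n \in F -> g n = 1%g) -> V (1%g, g)) ->
  (forall n, dense (action_orbit a (x n))) ->
  (forall n, n \in F -> x n = y n) ->
  closure [set jump P a v x | v in V] y.
Proof.
move=> VF dx xy O /nbhs_ptws_box[H [U [yU UO]]].
have /choice[g gP] n : exists g, (n \in F -> g = 1%g) /\ U n (a g (x n)).
  have [oU Uy] := yU n; have [nF|nF] := boolP (n \in F).
    by exists 1%g; rewrite act1 xy.
  have [_ [/[swap] [[g _ <-]] Ug]] := dx n (U n) (ex_intro _ _ Uy) oU.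
  by exists g.
exists (jump P a (1%g, g) x); split.
  by exists (1%g, g) => //; apply: VF => n; exact: (gP n).1.
by apply: UO => n _; exact: (gP n).2.
Qed.

(** The same element (q, g), where q is the inverse of a permutation p moving the
relevant indices into A, serves for x and for y: coordinate n of the image of x is
h n acting on x (p n), with h n chosen by density of the orbit of x (p n). *)
Lemma unbalanced_agree (A : set N) x y : absorbing P A ->
  (forall n, dense (action_orbit a (x n))) ->
  (forall n, dense (action_orbit a (y n))) ->
  (forall n, A n -> x n = y n) -> unbalanced (jump P a) x y.
Proof.
move=> absA dx dy xy V U [oV V1] oU Uxy.
have [w Uw] : U !=set0 by case: Uxy => -[w [Uw _]]; exists w.
have [H [B [wB BU]]] := nbhs_ptws_box (open_nbhs_nbhs (conj oU Uw)).
have [F VF] := nbhs1_wreath (open_nbhs_nbhs (conj oV V1)).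
have [p Pp pA] := absA (H ++ F).
have /choice[h hP] n : exists h, B n (a h (x (p n))).
  have [oB Bw] := wB n.
  by have [_ [/[swap] [[h _ <-]] Bh]] := dx (p n) (B n) (ex_intro _ _ Bw) oB; exists h.
pose q : set_type P := ((SigSub (mem_set Pp) : set_type P)^-1)%g.
pose g : {ptws N -> G} := fun n => h (val q n).
have jE z n : jump P a (q, g) z n = a (h n) (z (p n)).
  by rewrite /= /jump_fun /= /g (_ : val q (p n) = n)//; exact: sym_funK.
have xyE n : n \in H ++ F -> jump P a (q, g) x n = jump P a (q, g) y n.
  by move=> /pA /xy xyn; rewrite !jE xyn.
have d z : (forall n, dense (action_orbit a (z n))) ->
    forall n, dense (action_orbit a (jump P a (q, g) z n)).
  by move=> dz n; rewrite jE action_orbit_act.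
exists (q, g), (q, g); split.
- by apply: BU => n _; rewrite jE; exact: hP.
- apply: BU => n nH; rewrite -xyE ?mem_cat ?nH// jE; exact: hP.
- apply: closure_wreath_translate VF (d _ dx) _ => n nF.
  by rewrite xyE// mem_cat nF orbT.
- apply: closure_wreath_translate VF (d _ dy) _ => n nF.
  by rewrite xyE// mem_cat nF orbT.
Qed.

End Jump.

Theorem theorem1p5 (R : realType) (G : topologicalGroupType)
    (X : topologicalType) (a : continuousAction G X)
    (N : countType) (P : permGroup N) :
  polish R G -> polish R X ->
  (exists x : X, dense (action_orbit a x)) ->
  (forall n : N, infinite_set [set p n | p in perm_set P]) ->
  generically_semi_connected (jump P a).
Proof.
move=> _ pX dX infP C _ cC.
have scX := polish_second_countable pX.
have [A [absA absA']] := absorbing_split infP.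
pose C' := C `&` [set z : {ptws N -> X} | forall n, dense (action_orbit a (z n))].
have cC' : comeager C' by apply: comeagerI => //; exact: dense_orbit_comeager_ptws.
exists (C' `&` [set x | comeager [set z | C' (splice A x z)]]); split.
- by move=> x [[]].
- apply: comeagerI => //; apply: comeager_splice => //.
  exact: second_countable_ptws.
move=> x y [C'x cx] [C'y cy].
have dz := baire_comeager_dense (polish_ptws_baire (N := N) pX) (comeagerI cx cy).
have [z [_ [C'xz C'yz]]] := dz setT (ex_intro _ x Logic.I) openT.
exists 3, (fun i => nth y [:: x; splice A x z; splice A y z; y] i); split=> //.
- by case=> [|[|[|[|]]]] // _; [exact: C'x.1|exact: C'xz.1|exact: C'yz.1|exact: C'y.1].
- case=> [|[|[|]]] //= _.
  + apply: (unbalanced_agree absA C'x.2 C'xz.2) => n An; exact/esym/splice_in.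
  + by apply: (unbalanced_agree absA' C'xz.2 C'yz.2) => n nAn; rewrite !splice_out.
  + by apply: (unbalanced_agree absA C'yz.2 C'y.2) => n An; exact: splice_in.
Qed.
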